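(* Let $f(x)=\sum_{n\ge 1} a_n x^n$, where $a_n$ is the number of permutations of length $n$ that avoid both $4213$ and $3142$. Then $f$ satisfies \[ x^3f^6+(7x^3-7x^2+2x)f^5+(x^4+14x^3-21x^2+10x-1)f^4+(4x^4+8x^3-19x^2+11x-2)f^3+(6x^4-5x^3-2x^2+2x)f^2+(4x^4-7x^3+4x^2-x)f+x^4-2x^3+x^2=0. \]
   Context: A permutation $\pi$ of length $n$ contains a permutation $\sigma$ of length $k$ if $\pi$ has a subsequence of length $k$ order-isomorphic to $\sigma$; otherwise $\pi$ avoids $\sigma$. The generating function counts nonempty permutations only (no constant term). *)

(* Defs.v *)
From mathcomp Require Import all_boot all_order all_algebra all_fingroup.
Set Implicit Arguments. Unset Strict Implicit. Unset Printing Implicit Defensive.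
Import Order.TTheory GRing.Theory Num.Theory.
Local Open Scope ring_scope.

(* A pattern of length k is given as the sequence of its values, 0-based:
   e.g. 4213 is [:: 3; 1; 0; 2]. *)
Definition contains (n : nat) (s : 'S_n) (pat : seq nat) : bool :=
  [exists phi : {ffun 'I_(size pat) -> 'I_n},
     [forall i : 'I_(size pat), forall j : 'I_(size pat),
        ((i < j)%N ==> (phi i < phi j)%N) &&
        (((s (phi i) < s (phi j))%N) == (nth 0%N pat i < nth 0%N pat j)%N)]].

Definition avoids (n : nat) (s : 'S_n) (pat : seq nat) : bool := ~~ contains s pat.

Definition pat4213 : seq nat := [:: 3; 1; 0; 2]%N.
Definition pat3142 : seq nat := [:: 2; 0; 3; 1]%N.

Definition count_av (n : nat) : nat :=
  #|[set s : 'S_n | avoids s pat4213 && avoids s pat3142]|.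

Definition series := nat -> int.
Definition sadd (F G : series) : series := fun n => F n + G n.
Definition smul (F G : series) : series :=
  fun n => \sum_(i < n.+1) F i * G (n - i)%N.
Definition sone : series := fun n => if n == 0%N then 1 else 0.
Definition szero : series := fun _ => 0.
Definition spow (F : series) (k : nat) : series := iter k (smul F) sone.
Definition spoly (cs : seq int) : series := fun n => nth 0 cs n.

Definition f_av : series := fun n => if n == 0%N then 0 else (count_av n)%:Z.

Definition eqn_terms : seq (seq int * nat) :=
  [:: ([:: 0; 0; 0; 1], 6%N);
      ([:: 0; 2; -7; 7], 5%N);
      ([:: -1; 10; -21; 14; 1], 4%N);
      ([:: -2; 11; -19; 8; 4], 3%N);
      ([:: 0; 2; -2; -5; 6], 2%N);
      ([:: 0; -1; 4; -7; 4], 1%N);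
      ([:: 0; 0; 1; -2; 1], 0%N)].

Definition eval_eqn (F : series) : series :=
  foldr sadd szero [seq smul (spoly p.1) (spow F p.2) | p <- eqn_terms].

(* Main.v *)
Require Import Defs.
From HB Require Import structures.
From mathcomp Require Import all_boot all_order all_algebra all_fingroup.
From mathcomp Require Import boolp zify ring.

(** Write a nonempty permutation avoiding 4213 and 3142 around its minimum as
    [L 0 R].  No descent of [L] may have a value of [R] strictly between its two
    entries, nor conversely, so [L] and [R] are direct sums of blocks that
    alternate in value; the part of [R] lying below [max L] must avoid 213, and
    the part lying above is an arbitrary member of the class.  Peeling off the
    top block of such a pair exchanges the roles of the two words.  With
    [F = 1 + f], [C] and [J] the series of all 213-avoiding and all increasing
    permutations, and [k(P, Q)] that of the pairs whose first word satisfies [P]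
    and contains the maximum and whose second word satisfies [Q] (the empty pair
    included), this gives
      f = x F k(A, 213),                k(A, 213) = 1 + f k(213, A),
      k(213, A) = 1 + (C - 1) k(A, 21), k(A, 21) = 1 + f k(21, A),
      k(21, A) = 1 + (J - 1) k(A, 21),  C = 1 + x C^2,  J = 1 + x J,
    and elimination yields x times the claimed equation. *)

Set Implicit Arguments.
Unset Strict Implicit.
Unset Printing Implicit Defensive.
Import GRing.Theory.

(** * The commutative ring of integer power series *)

Section SeriesRing.
Local Open Scope ring_scope.

Definition sopp (F : series) : series := fun n => - F n.

(** Coefficients below [N] only see truncations, so ring laws pass from [{poly int}] to the Cauchy
    product. *)
Lemma smul_coef N (F G : series) n : (n < N)%N ->
  smul F G n = ((\poly_(i < N) F i) * (\poly_(i < N) G i))`_n.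
Proof.
move=> ltnN; rewrite coefM; apply: eq_bigr => i _.
by rewrite !coef_poly !(leq_ltn_trans _ ltnN) ?leq_subr // -ltnS.
Qed.

Lemma saddA : associative sadd.
Proof. by move=> F G H; apply: funext => n; rewrite /sadd addrA. Qed.

Lemma saddC : commutative sadd.
Proof. by move=> F G; apply: funext => n; rewrite /sadd addrC. Qed.

Lemma sadd0 : left_id szero sadd.
Proof. by move=> F; apply: funext => n; rewrite /sadd add0r. Qed.

Lemma saddN : left_inverse szero sopp sadd.
Proof. by move=> F; apply: funext => n; rewrite /sadd /sopp addNr. Qed.

Lemma smulC : commutative smul.
Proof.
by move=> F G; apply: funext => n; rewrite !(@smul_coef n.+1) // mulrC.
Qed.

Lemma smulA : associative smul.
Proof.
move=> F G H; apply: funext => n.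
pose P (F : series) := \poly_(i < n.+1) F i.
(* [P (smul A B)] and [P A * P B] differ only above degree [n], out of reach of the coefficient at
   [n]. *)
have smulE A B (p : {poly int}) : (p * P (smul A B))`_n = (p * (P A * P B))`_n.
  rewrite !coefM; apply: eq_bigr => i _; congr (_ * _).
  by rewrite coef_poly ltnS leq_subr -smul_coef // ltnS leq_subr.
rewrite !(@smul_coef n.+1) // -!/(P _) smulE [in RHS]mulrC smulE.
by congr (_`_n); rewrite mulrA mulrC.
Qed.

Lemma smul1 : left_id sone smul.
Proof.
move=> F; apply: funext => n; rewrite /smul big_ord_recl subn0 mul1r.
by rewrite big1 ?addr0 // => i _; rewrite mul0r.
Qed.

Lemma smulDl : left_distributive smul sadd.
Proof.
move=> F G H; apply: funext => n; rewrite /smul /sadd -big_split.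
by apply: eq_bigr => i _; rewrite mulrDl.
Qed.

Lemma sone_neq0 : sone != szero.
Proof. by apply/eqP => /(congr1 (@^~ 0%N)). Qed.

HB.instance Definition _ := gen_eqMixin series.
HB.instance Definition _ := gen_choiceMixin series.
End SeriesRing.

HB.instance Definition _ :=
  GRing.isZmodule.Build series saddA saddC sadd0 saddN.
HB.instance Definition _ :=
  GRing.Zmodule_isComNzRing.Build series smulA smulC smul1 smulDl sone_neq0.

(** * The indeterminate and the elimination of the auxiliary series *)

Section SeriesTheory.
Local Open Scope ring_scope.

Definition sX : series := fun n => (n == 1%N)%:Z.

Lemma sXM0 (F : series) : (sX * F) 0%N = 0.
Proof. by rewrite [LHS]big_ord1 mul0r. Qed.

Lemma sXMS (F : series) n : (sX * F) n.+1 = F n.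
Proof.
rewrite [LHS]big_ord_recl mul0r add0r big_ord_recl mul1r subSS subn0.
by rewrite big1 ?addr0 // => i _; rewrite mul0r.
Qed.

Lemma sXI (F : series) : sX * F = 0 -> F = 0.
Proof.
move=> XF0; apply: funext => n.
by rewrite -sXMS XF0.
Qed.

(** Horner's rule, which turns coefficient lists into expressions in [sX] open to the [ring]
    tactic. *)
Lemma spoly_cons c cs : spoly (c :: cs) = c%:~R + sX * spoly cs.
Proof.
have intE (m : nat) : (m%:R : series) 0%N = m%:Z /\ forall n, (m%:R : series) n.+1 = 0.
  elim: m => [|m [IH0 IHS]]; first by [].
  rewrite -natr1; split=> [|n].
    by change ((m%:R : series) 0%N + 1 = m.+1%:Z); rewrite IH0; lia.
  by change ((m%:R : series) n.+1 + 0 = 0); rewrite IHS.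
have {}intE : (c%:~R : series) 0%N = c /\ forall n, (c%:~R : series) n.+1 = 0.
  case: c => m; first exact: intE.
  rewrite NegzE mulrNz; split=> [|n].
    by change (- (m.+1%:R : series) 0%N = - m.+1%:Z); rewrite (intE _).1.
  by change (- (m.+1%:R : series) n.+1 = 0); rewrite (intE _).2 oppr0.
apply: funext => -[|n].
  by change (c = (c%:~R : series) 0%N + (sX * spoly cs) 0%N); rewrite sXM0 addr0 intE.1.
change (nth 0 cs n = (c%:~R : series) n.+1 + (sX * spoly cs) n.+1).
by rewrite sXMS intE.2 add0r.
Qed.

Lemma spoly_nil : spoly [::] = 0.
Proof. by apply: funext => n; rewrite /spoly nth_nil. Qed.

Lemma spowE F k : spow F k = F ^+ k.
Proof. by elim: k => // k IH; rewrite exprS -IH. Qed.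

Lemma eval_eqn_system (f C J k1 k2 k3 k4 : series) :
  f = sX * (1 + f) * k1 ->
  k1 = 1 + f * k2 -> k2 = 1 + (C - 1) * k3 ->
  k3 = 1 + f * k4 -> k4 = 1 + (J - 1) * k3 ->
  C = 1 + sX * C * C -> J = 1 + sX * J -> eval_eqn f = 0.
Proof.
move=> ef e1 e2 e3 e4 eC eJ.
have ek3 : (1 - sX * (1 + f)) * k3 = (1 - sX) * (1 + f).
  (* Each added term is a multiple of the difference between the two sides of a hypothesis.
     Rewriting makes these differences vanish, and a polynomial identity remains; the same device
     serves below. *)
  have -> : (1 - sX) * (1 + f) =
      (1 - sX) * (1 + f) + (k3 - (1 + f * k4)) * (1 - sX)
     + (k4 - (1 + (J - 1) * k3)) * f * (1 - sX) + (J - (1 + sX * J)) * f * k3.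
    rewrite -e3 -e4 -eJ; ring.
  ring.
(* Solving the equations for [f], [k1], [k2] and [ek3] for [C - 1] gives [N / E]; the denominator is
   kept as a factor, so no series is inverted. *)
pose E := sX * (1 + f) ^+ 2 * f * (1 - sX).
pose N := (1 - sX * (1 + f)) * (f - sX * (1 + f) ^+ 2).
have ED : E * (C - 1) = N.
  have -> : N = N - (1 - sX * (1 + f)) * (f - sX * (1 + f) * k1)
     - (1 - sX * (1 + f)) * (k1 - (1 + f * k2)) * sX * (1 + f)
     - (1 - sX * (1 + f)) * (k2 - (1 + (C - 1) * k3)) * sX * (1 + f) * f
     - ((1 - sX * (1 + f)) * k3 - (1 - sX) * (1 + f)) * sX * (1 + f) * f * (C - 1).
    rewrite ek3 -e2 -e1 -ef; ring.
  rewrite /E /N; ring.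
(* Since [E * C = E + N], this is [C - 1 = sX * C ^+ 2] multiplied by [E ^+ 2]. *)
have EN : E * N = sX * (E + N) ^+ 2.
  have -> : E * N = E * N - E ^+ 2 * (C - (1 + sX * C * C)).
    by rewrite -eC; ring.
  rewrite -ED; ring.
apply: sXI.
have <- : sX * (E + N) ^+ 2 - E * N = 0 by rewrite EN subrr.
rewrite /eval_eqn (eq_map (g := fun p => spoly p.1 * f ^+ p.2)); last first.
  by move=> p; rewrite spowE.
rewrite /= !spoly_cons spoly_nil.
rewrite -[sadd]/(@GRing.add series) -[szero]/(0 : series).
rewrite /E /N; ring.
Qed.
End SeriesTheory.

(** * Generating functions of classes: bijections, sums and products *)

Section Counting.

(** A duplicate-free list for each size shows finiteness and yields the coefficient, so [T] may be
    infinite and [X] any proposition. *)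
Definition counts (T : eqType) (X : T -> Prop) (sz : T -> nat) (a : series) :=
  forall n, exists s : seq T,
    [/\ uniq s, forall t, t \in s <-> X t /\ sz t = n & a n = Posz (size s)].

Lemma counts_unique (T : eqType) (X : T -> Prop) sz a b :
  counts X sz a -> counts X sz b -> a = b.
Proof.
move=> ca cb; apply: funext => n.
have [s [us sP ->]] := ca n; have [t [ut tP ->]] := cb n.
congr Posz; apply: perm_size; apply: uniq_perm => // x.
by apply/idP/idP => [/sP/tP|/tP/sP].
Qed.

Lemma counts_image (T U : eqType) (X : T -> Prop) (Y : U -> Prop) szX szY
    (f : T -> U) a :
  (forall t, X t -> Y (f t) /\ szY (f t) = szX t) ->
  (forall t1 t2, X t1 -> X t2 -> f t1 = f t2 -> t1 = t2) ->
  (forall u, Y u -> exists2 t, X t & f t = u) ->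
  counts X szX a -> counts Y szY a.
Proof.
move=> fXY finj fsurj ca n; have [s [us sP an]] := ca n.
exists (map f s); split; last by rewrite size_map.
  by rewrite map_inj_in_uniq // => t1 t2 /sP[X1 _] /sP[X2 _]; apply: finj.
move=> u; split=> [/mapP[t /sP[Xt <-] ->]|[Yu szu]]; first exact: fXY.
have [t Xt ftu] := fsurj u Yu; apply/mapP; exists t => //; apply/sP; split=> //.
by rewrite -szu -ftu (fXY t Xt).2.
Qed.

Lemma counts_add (T : eqType) (X Y : T -> Prop) sz a b :
  (forall t, X t -> ~ Y t) -> counts X sz a -> counts Y sz b ->
  counts (fun t => X t \/ Y t) sz (a + b)%R.
Proof.
move=> XY ca cb n; have [s [us sP an]] := ca n; have [t [ut tP bn]] := cb n.
exists (s ++ t); split; last by rewrite size_cat PoszD -an -bn.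
  rewrite cat_uniq us ut andbT; apply/hasPn => x /tP[Yx _].
  by apply/negP => /sP[Xx _]; apply: XY Yx.
move=> x; rewrite mem_cat; split=> [/orP[/sP|/tP]|].
- by case; split; [left|].
- by case; split; [right|].
by case=> -[Xx|Yx] szx; apply/orP; [left; apply/sP | right; apply/tP].
Qed.

Lemma counts_mul (T U : eqType) (X : T -> Prop) (Y : U -> Prop) szX szY a b :
  counts X szX a -> counts Y szY b ->
  counts (fun t => X t.1 /\ Y t.2) (fun t => szX t.1 + szY t.2) (a * b)%R.
Proof.
move=> /choice[s sP] /choice[t tP] n.
exists [seq p | i <- iota 0 n.+1, p <- [seq (x, y) | x <- s i, y <- t (n - i)]].
have mem_st i p : p \in [seq (x, y) | x <- s i, y <- t (n - i)] <->
    [/\ X p.1, Y p.2, szX p.1 = i & szY p.2 = n - i].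
  case: p => x y; split=> [/allpairsP[[x' y'] /= [xs yt [-> ->]]]|/= [Xx Yy ex ey]].
    have [_ sPi _] := sP i; have [_ tPi _] := tP (n - i).
    by have [? ?] := (sPi x').1 xs; have [? ?] := (tPi y').1 yt.
  apply: allpairs_f.
    by have [_ sPi _] := sP i; apply/sPi.
  by have [_ tPi _] := tP (n - i); apply/tPi.
split.
- apply: allpairs_uniq_dep => [|i _|].
  + exact: iota_uniq.
  + apply: allpairs_uniq; [by have [] := sP i|by have [] := tP (n - i)|].
    by move=> [? ?] [? ?].
  + move=> u v /allpairsPdep[i [p [_ /mem_st[_ _ ei _] ->]]].
    move=> /allpairsPdep[j [q [_ /mem_st[_ _ ej _] ->]]] /= epq.
    by rewrite -ei -ej epq.
- move=> p; split=> [/allpairsPdep[i [q [+ /mem_st[Xq Yq ei ej] ->]]]|[[Xp Yp] szp]].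
    by rewrite mem_iota => iln; split=> //; rewrite ei ej; lia.
  apply/allpairsPdep; exists (szX p.1), p; split=> //.
    by rewrite mem_iota; lia.
  by apply/mem_st; split=> //; lia.
rewrite size_allpairs_dep sumnE big_map -[iota 0 n.+1]/(index_iota 0 n.+1).
rewrite big_mkord (big_morph Posz PoszD (erefl _)); apply: eq_bigr => i _.
by rewrite size_allpairs PoszM; have [_ _ ->] := sP i; have [_ _ ->] := tP (n - i).
Qed.

Lemma counts1 (T : eqType) (X : T -> Prop) sz (t0 : T) :
  X t0 -> (forall t, X t -> t = t0) -> sz t0 = 0 -> counts X sz 1%R.
Proof.
move=> X0 X1 sz0 [|n]; [exists [:: t0] | exists [::]]; split=> //.
  move=> t; rewrite inE; split=> [/eqP->|[Xt _]]; first by [].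
  by apply/eqP/X1.
by move=> t; split=> // -[/X1-> ]; rewrite sz0.
Qed.

(** Finiteness alone provides a series, membership being decided classically. Unknown series can
    thus be named before any equation for them is known. *)
Lemma counts_filter (T : eqType) (X : T -> Prop) sz (s : nat -> seq T) :
  (forall n t, X t -> sz t = n -> t \in s n) -> exists a, counts X sz a.
Proof.
move=> Xs; pose r n := undup [seq t <- s n | `[< X t /\ sz t = n >]].
exists (fun n => Posz (size (r n))) => n; exists (r n).
split=> //; first exact: undup_uniq.
move=> t; rewrite mem_undup mem_filter; split=> [/andP[/asboolP]|[Xt szt]] //.
by rewrite (Xs n) // andbT; apply/asboolP.
Qed.

End Counting.

(** * Pattern avoidance in words, under direct sums and around the minimum *)

Section Avoidance.

Implicit Types (s t w L R B : seq nat).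

(** [p] recognizes occurrences instead of being one pattern, so that a single predicate covers both
    4213 and 3142. *)
Definition av (p : pred (seq nat)) w := forall s, subseq s w -> ~~ p s.

(** The first disjunct is 4213, the second 3142. *)
Definition occA : pred (seq nat) := fun s =>
  if s is [:: a; b; c; d] then
    (c < b < d) && (d < a) || (b < d < a) && (a < c) else false.
Definition occ213 : pred (seq nat) := fun s =>
  if s is [:: a; b; c] then b < a < c else false.
Definition occ21 : pred (seq nat) := fun s =>
  if s is [:: a; b] then b < a else false.

Definition below L B := forall x y, x \in L -> y \in B -> x < y.

Definition noncross L R :=
  forall x y r, subseq [:: x; y] L -> r \in R -> ~~ (y < r < x).

(** For disjoint words, a nonempty pair has its maximum in [L]; in particular an empty [L] forces an
    empty [R]. *)
Definition dominated R L := forall r, r \in R -> exists2 l, l \in L & r < l.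

Lemma subseq_catP s t1 t2 :
  subseq s (t1 ++ t2) ->
  exists s1 s2, [/\ s = s1 ++ s2, subseq s1 t1 & subseq s2 t2].
Proof.
case/subseqP => m szm ->; rewrite size_cat in szm.
exists (mask (take (size t1) m) t1), (mask (drop (size t1) m) t2).
rewrite !mask_subseq; split=> //; rewrite -{1}[m](cat_take_drop (size t1)).
by rewrite mask_cat // size_takel // szm leq_addr.
Qed.

Lemma subseq_mapP (f : nat -> nat) s w :
  subseq s (map f w) -> exists2 t, subseq t w & s = map f t.
Proof.
case/subseqP => m szm ->; exists (mask m w); first exact: mask_subseq.
by rewrite map_mask.
Qed.

Lemma av_sub p s w : subseq s w -> av p w -> av p s.
Proof. by move=> sw avw t ts; apply: avw; apply: subseq_trans sw. Qed.

Lemma av_map p (f : nat -> nat) w : (forall s, p (map f s) = p s) ->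
  av p (map f w) <-> av p w.
Proof.
move=> pf; split=> avw s.
  by move=> sw; rewrite -pf; apply: avw; apply: map_subseq.
by case/subseq_mapP => t tw ->; rewrite pf; apply: avw.
Qed.

Lemma occA_map (f : nat -> nat) s : {mono f : x y / x < y} ->
  occA (map f s) = occA s.
Proof. by move=> fm; case: s => [|a[|b[|c[|d[]]]]] //=; rewrite !fm. Qed.

Lemma occ213_map (f : nat -> nat) s : {mono f : x y / x < y} ->
  occ213 (map f s) = occ213 s.
Proof. by move=> fm; case: s => [|a[|b[|c[]]]] //=; rewrite !fm. Qed.

Lemma occ21_map (f : nat -> nat) s : {mono f : x y / x < y} ->
  occ21 (map f s) = occ21 s.
Proof. by move=> fm; case: s => [|a[|b[]]] //=; rewrite !fm. Qed.

Lemma below_subseq L B s t :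
  below L B -> subseq s L -> subseq t B -> below s t.
Proof. by move=> LB /mem_subseq sL /mem_subseq tB x y /sL xL /tB; apply: LB. Qed.

(** 4213 and 3142 are sum-indecomposable, so no occurrence meets both summands. *)
Lemma avA_cat L B : below L B ->
  av occA (L ++ B) <-> av occA L /\ av occA B.
Proof.
move=> LB; split=> [avLB|[avL avB] s /subseq_catP[s1 [s2 [-> s1L s2B]]]].
  by split; apply: av_sub avLB; [exact: prefix_subseq | exact: suffix_subseq].
have := below_subseq LB s1L s2B.
case: s1 s1L => [_|a s1 s1L]; first by move=> _; apply: avB.
case: s2 s2B => [_|b s2 _]; first by move=> _; rewrite cats0; apply: avL.
move=> lts; apply/negP.
have lt x y : x \in a :: s1 -> y \in b :: s2 -> x < y by exact: lts.
case: s1 s2 lt {s1L lts} => [|c[|d[|? s1]]] [|e[|g[|? s2]]] //= lt.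
- have := lt a b; have := lt a e; have := lt a g.
  rewrite !inE !eqxx !orbT; lia.
- have := lt a b; have := lt a e; have := lt c b; have := lt c e.
  rewrite !inE !eqxx !orbT; lia.
- have := lt a b; have := lt c b; have := lt d b.
  rewrite !inE !eqxx !orbT; lia.
all: by case: s1 {lt}.
Qed.

(** 213 is the direct sum of 21 and 1: any entry of the nonempty upper summand completes a descent
    of [L] to a 213. *)
Lemma av213_cat L B : below L B -> B != [::] ->
  av occ213 (L ++ B) <-> av occ21 L /\ av occ213 B.
Proof.
move=> LB B0; split=> [avLB|[avL avB] s /subseq_catP[s1 [s2 [-> s1L s2B]]]].
  split; last by apply: av_sub avLB; exact: suffix_subseq.
  case: B B0 LB avLB => // b B _ LB avLB [|x[|y[]]] // sL.
  have : subseq ([:: x; y] ++ [:: b]) (L ++ b :: B).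
    by apply: cat_subseq => //=; rewrite eqxx sub0seq.
  move=> /avLB; have := LB x b; rewrite inE eqxx (mem_subseq sL) ?mem_head //=; lia.
have lt := below_subseq LB s1L s2B.
case: s1 s1L lt => [|x[|y[|z[|? s1]]]] s1L lt; first exact: avB.
- case: s2 s2B lt => [|a [|b[]]] //= s2B lt.
  have := lt x a; rewrite !inE !eqxx; lia.
- by have := avL _ s1L; case: s2 s2B lt => [|a []] //= ? _; lia.
- case: s2 s2B lt => //= _ _.
  have /avL : subseq [:: x; y] L by apply: subseq_trans s1L; rewrite /= !eqxx.
  by rewrite /=; lia.
by case: s2 s2B lt.
Qed.

Lemma av21_cat L B : below L B ->
  av occ21 (L ++ B) <-> av occ21 L /\ av occ21 B.
Proof.
move=> LB; split=> [avLB|[avL avB] s /subseq_catP[s1 [s2 [-> s1L s2B]]]].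
  by split; apply: av_sub avLB; [exact: prefix_subseq | exact: suffix_subseq].
have lt := below_subseq LB s1L s2B.
case: s1 s1L lt => [|x[|y[|z s1]]] s1L lt; first exact: avB.
- case: s2 s2B lt => [|a[]] //= s2B lt; have := lt x a; rewrite !inE !eqxx; lia.
- by have := avL _ s1L; case: s2 {lt s2B}.
by [].
Qed.

(** Drop the 4 from 4213 or the 2 from 3142; comparing the two middle letters tells which pattern is
    present. *)
Lemma occA_occ213 s : occA s -> exists2 t, subseq t s & occ213 t.
Proof.
case: s => [|a[|b[|c[|d[]]]]] // /orP H.
exists (if c < b then [:: b; c; d] else [:: a; b; c]).
  by case: ifP => _; [exact: subseq_cons | exact: (prefix_subseq [:: a; b; c])].
by case: ifP => /= ?; lia.
Qed.

(** A descent [x y] of [L] around [r] gives the 4213 [x y 0 r]; one of [R] gives the 3142 [r 0 x y].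
    Domination is not assumed, so that this applies before the top part of [R] is split off. *)
Lemma avA_min_noncross L R : (forall x, x \in L ++ R -> 0 < x) ->
  av occA (L ++ 0 :: R) -> noncross L R /\ noncross R L.
Proof.
move=> pos0 avw; split=> x y r.
  move=> sL rR; have : subseq ([:: x; y] ++ [:: 0; r]) (L ++ 0 :: R).
    by apply: cat_subseq => //; rewrite /= sub1seq.
  have := pos0 y; rewrite mem_cat (mem_subseq sL) ?inE ?eqxx ?orbT // => /(_ isT).
  by move=> y0 /avw /=; lia.
move=> sR rL; have : subseq ([:: r] ++ [:: 0; x; y]) (L ++ 0 :: R).
  by apply: cat_subseq => //; rewrite ?sub1seq //= eqxx.
have := pos0 y; rewrite mem_cat (mem_subseq sR) ?inE ?eqxx ?orbT // => /(_ isT).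
by move=> y0 /avw /=; lia.
Qed.

(** Domination supplies a letter of [L] above any 213 of [R], which makes a 4213. Conversely,
    occurrences are sorted by the number of their letters in [L]. *)
Lemma avA_min L R : (forall x, x \in L ++ R -> 0 < x) -> dominated R L ->
  av occA (L ++ 0 :: R) <->
  [/\ av occA L, av occ213 R, noncross L R & noncross R L].
Proof.
move=> pos0 domR; split=> [avw|[avL avR ncL ncR]].
  have [ncL ncR] := avA_min_noncross pos0 avw.
  split=> //; first by apply: av_sub avw; exact: prefix_subseq.
  case=> [|a[|b[|c[]]]] //= sR.
  have [|m mL cm] := domR c; first by rewrite (mem_subseq sR) ?inE ?eqxx ?orbT.
  have : subseq ([:: m] ++ [:: a; b; c]) (L ++ 0 :: R).
    apply: cat_subseq; first by rewrite sub1seq.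
    exact: subseq_trans sR (subseq_cons _ _).
  by move=> /avw /=; lia.
move=> s /subseq_catP[s1 [s2 [-> s1L s2R]]]; apply/negP => occ.
case: s1 s1L occ => [|a[|b s1]] s1L occ.
- case: s2 s2R occ => [|a s2] //=; case: eqP => [->|_] sR occ.
    by case: s2 sR occ => [|b[|c[|d[]]]] //=; lia.
  have [t ts] := @occA_occ213 (a :: s2) occ; apply/negP/avR.
  exact: subseq_trans ts sR.
- have aL : a \in L by rewrite -sub1seq.
  case: s2 s2R occ => [|b[|c[|d[]]]] //=; rewrite -/(subseq [:: c; d] R).
  (* If [b] is the minimum, the occurrence is a 3142 whose descent [c d] straddles [a]. Otherwise a
     4213 leaves a 213 in [R], and a 3142 crosses as before. *)
  case: eqP => [->|_] sR occ.
    by have := ncR c d a sR aL; lia.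
  have /avR /= : subseq [:: b; c; d] R by [].
  have : subseq [:: c; d] R by apply: subseq_trans sR; apply: subseq_cons.
  by move=> /ncR/(_ aL); lia.
(* In both patterns the last letter lies strictly between the first two, so with two or three
   letters in [L] the descent [a b] is crossed by [d]. *)
have sL : subseq [:: a; b] L by apply: subseq_trans s1L; exact: (prefix_subseq [:: a; b]).
have mem0 d : d \in s2 -> 0 < d -> d \in R.
  move=> /(mem_subseq s2R); rewrite inE => /orP[/eqP->|] //.
case: s1 s1L occ => [|c[|d s1]] s1L occ.
- case: s2 {s2R} mem0 occ => [|c[|d[]]] //= mem0 occ.
  have dR : d \in R by apply: mem0; [rewrite !inE eqxx ?orbT | lia].
  by have := ncL _ _ d sL dR; lia.
- case: s2 {s2R} mem0 occ => [|d[]] //= mem0 occ.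
  have dR : d \in R by apply: mem0; [rewrite !inE eqxx ?orbT | lia].
  by have := ncL _ _ d sL dR; lia.
case: s1 s2 s1L occ {mem0 s2R} => [|? ?] [|? ?] //= /avL /=; lia.
Qed.
(** Otherwise [x 0 r] would be a 213. *)
Lemma av213_min L R : (forall x, x \in L ++ R -> 0 < x) ->
  av occ213 (L ++ 0 :: R) -> forall x r, x \in L -> r \in R -> r <= x.
Proof.
move=> pos0 avw x r xL rR.
have : subseq ([:: x] ++ [:: 0; r]) (L ++ 0 :: R).
  by apply: cat_subseq => //; rewrite /= sub1seq.
have := pos0 x; rewrite mem_cat xL => /(_ isT) x0.
by move=> /avw /=; lia.
Qed.

(** A 213 ends in its largest letter, so it cannot start in [L] and end to the right of [L]; nor can
    it start at the minimum. *)
Lemma av213_min_cat L R : below R L -> (forall x, x \in L ++ R -> 0 < x) ->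
  av occ213 (L ++ 0 :: R) <-> av occ213 L /\ av occ213 R.
Proof.
move=> RL pos0; split=> [avw|[avL avR] s /subseq_catP[s1 [s2 [-> s1L s2R]]]].
  split; apply: av_sub avw; first exact: prefix_subseq.
  exact: subseq_trans (subseq_cons _ _) (suffix_subseq _ _).
have lt x y : x \in s1 -> y \in s2 -> (y == 0) || (y < x).
  move=> /(mem_subseq s1L) xL /(mem_subseq s2R); rewrite inE.
  by case/orP=> [-> //|yR]; rewrite (RL y x) ?orbT.
case: s1 s1L lt => [|x[|y[|z s1]]] s1L lt.
- case: s2 s2R {lt} => [|a s2] //; rewrite [subseq _ _]/=.
  by case: eqP => [->|_] sR; [case: s2 sR => [|b[|c[]]] | apply: avR].
- case: s2 s2R lt => [|b[|c[]]] //= _ lt.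
  have := lt x c; rewrite !inE !eqxx ?orbT => /(_ isT isT); lia.
- case: s2 s2R lt => [|c[]] //= _ lt.
  have := lt x c; rewrite !inE !eqxx ?orbT => /(_ isT isT); lia.
case: s1 s2 s1L {s2R lt} => [|? ?] [|? ?] //.
by rewrite cats0; apply: avL.
Qed.

Lemma av21_min R : av occ21 (0 :: R) <-> av occ21 R.
Proof.
split=> [|avR [|a s] //]; first by apply: av_sub; exact: subseq_cons.
rewrite [subseq _ _]/=; case: eqP => [->|_] sR; last exact: avR.
by case: s sR => [|b[]].
Qed.
End Avoidance.

(** * Words that are permutations of an initial segment, and their direct sums *)

Section PermWords.

Implicit Types (u v w L R B : seq nat).

Definition isperm w := uniq w /\ forall x, x \in w -> x < size w.

Lemma isperm_iota w : isperm w <-> perm_eq w (iota 0 (size w)).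
Proof.
split=> [[uw ltw]|wi].
  apply: uniq_perm => //; first exact: iota_uniq.
  apply: (uniq_min_size uw _ _).2; last by rewrite size_iota.
  by move=> x /ltw; rewrite mem_iota.
split=> [|x]; first by rewrite (perm_uniq wi) iota_uniq.
by rewrite (perm_mem wi) mem_iota.
Qed.

Lemma isperm_mem w x : isperm w -> (x \in w) = (x < size w).
Proof. by move=> /isperm_iota/perm_mem->; rewrite mem_iota. Qed.

Lemma perm_isperm v w : perm_eq v w -> isperm v -> isperm w.
Proof.
move=> vw [uv ltv]; split=> [|x]; first by rewrite -(perm_uniq vw).
by rewrite -(perm_mem vw) -(perm_size vw); apply: ltv.
Qed.

Lemma ispermC u v : isperm (u ++ v) -> isperm (v ++ u).
Proof. by apply: perm_isperm; rewrite perm_catC. Qed.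

Definition shift k w := map (addn k) w.

Lemma size_shift k w : size (shift k w) = size w.
Proof. exact: size_map. Qed.

Lemma shift_inj k : injective (shift k).
Proof. exact: inj_map (@addnI k). Qed.

Lemma mem_shift k w x : x \in shift k w -> k <= x.
Proof. by case/mapP => y _ ->; rewrite leq_addr. Qed.

Lemma isperm_cat u v : isperm u -> isperm v -> isperm (u ++ shift (size u) v).
Proof.
move=> [uu ltu] [uv ltv]; split=> [|x].
  rewrite cat_uniq uu map_inj_uniq ?uv ?andbT; last exact: addnI.
  by apply/hasPn => x /mem_shift xu; apply/negP => /ltu; lia.
rewrite mem_cat size_cat size_shift => /orP[/ltu|/mapP[y /ltv]]; lia.
Qed.

Lemma isperm_cat_split u v : below u v -> isperm (u ++ v) ->
  isperm u /\ exists2 w, isperm w & v = shift (size u) w.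
Proof.
move=> uv uvP; have [+ ltuv] := uvP.
rewrite cat_uniq => /and3P[uu _ vv].
have ltu x : x \in u -> x < size u.
  (* The [x.+1] values up to [x] all occur in the permutation and none of them in [v], so [u] has at
     least that many entries. *)
  move=> xu; rewrite -[x.+1](size_iota 0); apply: uniq_leq_size => [|y].
    exact: iota_uniq.
  rewrite mem_iota /= add0n => ylx.
  have: y \in u ++ v.
    by rewrite isperm_mem // (leq_ltn_trans _ (ltuv x _)) // mem_cat xu.
  by rewrite mem_cat => /orP[// | /(uv _ _ xu)]; lia.
have gev y : y \in v -> size u <= y.
  move=> yv; rewrite -[y](size_iota 0); apply: uniq_leq_size => // x xu.
  by rewrite mem_iota /= add0n; apply: uv.
split; first by [].
have evE : v = shift (size u) (map (subn^~ (size u)) v).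
  rewrite /shift -map_comp -[LHS]map_id; apply/eq_in_map => y /gev /=; lia.
exists (map (subn^~ (size u)) v) => //; split.
  rewrite map_inj_in_uniq // => x y /gev + /gev; lia.
move=> x /mapP[y yv ->]; rewrite size_map.
have := ltuv y; rewrite mem_cat yv orbT size_cat => /(_ isT).
have := gev y yv; lia.
Qed.

Lemma isperm_cons0 L R :
  isperm (L ++ R) <-> isperm (shift 1 L ++ 0 :: shift 1 R).
Proof.
have p0 : perm_eq (0 :: shift 1 (L ++ R)) (shift 1 L ++ 0 :: shift 1 R).
  by rewrite /shift map_cat -cat1s perm_catCA.
split=> [|/perm_isperm P].
  by move/(@isperm_cat [:: 0]) => P; apply: perm_isperm p0 (P _); split=> // x;
     rewrite inE => /eqP->.
have /P [/= /andP[_ u1] lt1] : perm_eq (shift 1 L ++ 0 :: shift 1 R) (0 :: shift 1 (L ++ R)).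
  by rewrite perm_sym.
split=> [|x xLR]; first by rewrite (map_inj_uniq (@addnI 1)) in u1.
have := lt1 (1 + x); rewrite size_shift inE map_f // orbT => /(_ isT); lia.
Qed.

Lemma isperm_split0 w : isperm w -> w != [::] ->
  exists L R, isperm (L ++ R) /\ w = shift 1 L ++ 0 :: shift 1 R.
Proof.
move=> wP w0; have w0in : 0 \in w by rewrite isperm_mem // lt0n size_eq0.
move: {w0} w0in wP => /splitPr w0in; case: w / w0in => L R wP.
have pos x : x \in L ++ R -> 0 < x.
  have [+ _] := wP; rewrite lt0n => u0 xLR; apply/eqP => x0.
  move: u0; rewrite -cat1s uniq_catCA /= -x0 xLR; by [].
have shiftK u : {subset u <= L ++ R} -> shift 1 (map predn u) = u.
  move=> uLR; rewrite /shift -map_comp -[RHS]map_id.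
  apply/eq_in_map => x /uLR/pos /=; lia.
exists (map predn L), (map predn R); rewrite isperm_cons0.
by rewrite !shiftK // => x xw; rewrite mem_cat xw ?orbT.
Qed.

(** A property passed on to all later letters holds on a suffix; this is how top blocks are cut
    off. *)
Lemma cat_filter_up (a : pred nat) w :
  (forall x y, subseq [:: x; y] w -> a x -> a y) ->
  w = filter (predC a) w ++ filter a w.
Proof.
elim: w => // x w IH aw /=.
have {}IH : w = filter (predC a) w ++ filter a w.
  by apply: IH => y z yzw; apply: aw; apply: subseq_trans (subseq_cons _ _).
case ax: (a x) => /=; last by rewrite -IH.
rewrite (_ : filter (predC a) w = [::]) /=.
  congr (_ :: _); apply/esym/all_filterP/allP => y yw.
  by apply: aw ax; rewrite /= eqxx sub1seq.
apply/eqP; rewrite -(negbK (_ == _)) -has_filter; apply/hasPn => y yw /=.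
by rewrite negbK; apply: aw ax; rewrite /= eqxx sub1seq.
Qed.

End PermWords.

(** * Permutation classes, interleaved pairs and the peeling of a top block *)

Section Classes.

Implicit Types (P Q : seq nat -> Prop) (w L R B T : seq nat).

Definition words P w := isperm w /\ P w.
Definition words1 P w := w != [::] /\ words P w.

Definition interleaved L R :=
  [/\ isperm (L ++ R), dominated R L, noncross L R & noncross R L].

Definition pairs P Q (p : seq nat * seq nat) :=
  [/\ interleaved p.1 p.2, P p.1 & Q p.2].

Definition psize (p : seq nat * seq nat) := size p.1 + size p.2.

Lemma counts_words1 P : exists a, counts (words1 P) size a.
Proof.
apply: (@counts_filter _ _ _ (fun n => permutations (iota 0 n))).
move=> n w [_ [wP _]] <-; rewrite mem_permutations perm_sym.
by rewrite perm_sym; apply/isperm_iota.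
Qed.

Lemma counts_pairs P Q : exists a, counts (pairs P Q) psize a.
Proof.
apply: (@counts_filter _ _ _ (fun n =>
  [seq (take i w, drop i w) | i <- iota 0 n.+1, w <- permutations (iota 0 n)])).
move=> n [L R] [[LRP _ _ _] _ _] <-; apply/allpairsP; exists (size L, L ++ R).
rewrite take_size_cat // drop_size_cat // mem_iota mem_permutations /psize /=.
by split=> //; [lia | rewrite -size_cat; apply/isperm_iota].
Qed.

Lemma counts_ext (T : eqType) (X Y : T -> Prop) sz a :
  (forall t, X t <-> Y t) -> counts X sz a -> counts Y sz a.
Proof.
move=> XY; apply: (@counts_image _ _ _ _ _ _ id) => // t; last by exists t; first apply/XY.
by move/XY.
Qed.

Lemma counts_words P a : P [::] ->
  counts (words1 P) size a -> counts (words P) size (1 + a)%R.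
Proof.
move=> P0 ca; apply: (@counts_ext _ (fun w => w = [::] \/ words1 P w)).
  move=> w; split=> [[->|[]]|wP] //.
  by case: (w =P [::]) => [|/eqP w0]; [left|right].
apply: counts_add ca => [w -> []//|]; exact: (@counts1 _ _ _ [::]).
Qed.

Lemma counts_atom (T : eqType) (X : T -> Prop) sz a :
  counts X sz a -> counts X (fun t => (sz t).+1) (sX * a)%R.
Proof.
move=> ca [|n]; first by exists [::]; split=> [||]; rewrite ?sXM0 // => t; split=> // -[].
have [s [us sP an]] := ca n; exists s; split=> // [t|]; last by rewrite sXMS.
by split=> [/sP[? ->]|[? [?]]] //; apply/sP.
Qed.

(* The values reached by [L ++ R] are those up to the maximum of [L]. *)
Lemma dominated_size L R R' : isperm (L ++ R) -> dominated R L ->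
  isperm (L ++ R') -> dominated R' L -> size R = size R'.
Proof.
wlog lt : R R' / size R < size R' => [W LR dR LR' dR'|].
  by case: (ltngtP (size R) (size R')) => // ltR; [|symmetry]; apply: W.
move=> LR dR LR' dR'; have [_ ltLR] := LR.
(* This value is too large for [L], yet it occurs in the larger permutation, where domination would
   put a still larger value in [L]. *)
have : size (L ++ R) \in L ++ R' by rewrite isperm_mem // !size_cat ltn_add2l.
rewrite mem_cat => /orP[xL|/dR'[x xL ltx]].
  by have := ltLR (size (L ++ R)); rewrite mem_cat xL ltnn => /(_ isT).
by have := ltLR x; rewrite mem_cat xL => /(_ isT); lia.
Qed.

Definition above R x := all (fun r => r < x) R.

(** A descent from above all of [R] to below some entry of [R] would be crossed by that entry, so
    the letters above [R] form a suffix. *)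
Lemma filter_above L R : isperm (L ++ R) -> noncross L R ->
  L = filter (predC (above R)) L ++ filter (above R) L.
Proof.
move=> LRP ncL; apply: cat_filter_up => x y xyL /allP Rx; apply/allP => r rR.
have := ncL _ _ _ xyL rR; have /= rx := Rx r rR.
rewrite rx andbT -leqNgt leq_eqVlt => /orP[/eqP ry|//].
have [+ _] := LRP; rewrite cat_uniq => /and3P[_ /hasPn/(_ r rR) /= + _].
by rewrite ry (mem_subseq xyL) // !inE eqxx orbT.
Qed.

(** Once the top block is gone the maximum is in [R], whence the exchange of roles. *)
Lemma dominated_filter_above L R : isperm (L ++ R) ->
  dominated (filter (predC (above R)) L) R.
Proof.
move=> LRP x; rewrite mem_filter => /andP[/allPn[r rR]].
rewrite -leqNgt leq_eqVlt => /orP[/eqP ex|ltx] xL; last by exists r.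
have [+ _] := LRP; rewrite cat_uniq => /and3P[_ /hasPn/(_ r rR) /= + _].
by rewrite -ex xL.
Qed.

Lemma noncross_sub L R L' R' : subseq L' L -> {subset R' <= R} ->
  noncross L R -> noncross L' R'.
Proof.
by move=> sL sR nc x y r xyL' /sR; apply: nc; apply: subseq_trans sL.
Qed.

(** The top block is made of the letters of the first word above the whole second word. It is an
    arbitrary nonempty member of [P1], and what is left, with the words exchanged, is again a
    dominated pair. [P1] and [P2] differ for 213, where the block avoids 213 and the rest 21. The 1
    counts the empty pair. *)
Lemma counts_peel P Q P1 P2 b k :
  (forall L B, below L B -> B != [::] -> P (L ++ B) <-> P2 L /\ P1 B) ->
  (forall m w, P1 (shift m w) <-> P1 w) -> P [::] -> Q [::] ->
  counts (words1 P1) size b -> counts (pairs Q P2) psize k ->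
  counts (pairs P Q) psize (1 + b * k)%R.
Proof.
move=> Pcat P1shift P0 Q0 cb ck.
apply: (@counts_ext _ (fun p => p = ([::], [::]) \/ p.1 != [::] /\ pairs P Q p)).
  move=> [L R]; split=> [[[-> ->]|[]]|LR] //.
  case: (L =P [::]) LR => [->|/eqP L0]; last by right.
  case: R => [|r R] [[_ + _ _] _ _]; first by left.
  by move=> /(_ r)[|x]; rewrite ?mem_head.
apply: counts_add; first by move=> _ -> [].
  by apply: (@counts1 _ _ _ ([::], [::])).
(* The inverse of peeling: the block is raised above the pair, appended to its second word, and the
   words are exchanged. *)
apply: (counts_image
  (f := fun t => (t.2.2 ++ shift (size t.2.1 + size t.2.2) t.1, t.2.1))
  _ _ _ (counts_mul cb ck)).
- move=> [B [R L]] [/= [B0 [Bp P1B]] [[/= RL dLR ncR ncL] QR P2L]].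
  have RLB : isperm ((R ++ L) ++ shift (size R + size L) B).
    by rewrite -size_cat; apply: isperm_cat.
  have ltB x y : x \in R ++ L -> y \in shift (size R + size L) B -> x < y.
    move=> xRL /mem_shift; apply: leq_trans; rewrite -size_cat.
    by have [_] := RL; apply.
  have B'0 : shift (size R + size L) B != [::] by case: (B) B0.
  split; last by rewrite /psize /= size_cat size_shift; lia.
  split=> /=; first by rewrite -size_eq0 size_cat addn_eq0 negb_and !size_eq0 B'0 orbT.
  split=> //=.
    split.
    + by apply: perm_isperm RLB; rewrite -catA perm_catC.
    + case: (shift _ B) ltB B'0 => // y B' ltB _ x xR; exists y.
        by rewrite mem_cat mem_head orbT.
      by apply: ltB; rewrite ?mem_head // mem_cat xR.
    + move=> x y r /subseq_catP[s1 [s2 [es s1L s2B]]] rR.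
      case: s1 es s1L => [|x' [|y' s1]] es s1L.
      * have : y \in s2 by rewrite -[s2]es !inE eqxx orbT.
        move=> /(mem_subseq s2B) yB.
        have := ltB r y; rewrite mem_cat rR => /(_ isT yB); lia.
      * have : y \in s2 by move: es => [_ <-]; rewrite inE.
        move=> /(mem_subseq s2B) yB.
        have := ltB r y; rewrite mem_cat rR => /(_ isT yB); lia.
      apply: ncL => //; case: es => -> -> _.
      exact: subseq_trans (prefix_subseq [:: x'; y'] s1) s1L.
    move=> x y r xyR; rewrite mem_cat => /orP[rL|rB]; first exact: ncR rL.
    have := ltB x r; rewrite mem_cat (mem_subseq xyR) ?mem_head // => /(_ isT rB).
    lia.
  by apply/Pcat => //; [move=> x y xL; apply: ltB; rewrite mem_cat xL orbT | rewrite P1shift].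
(* Equal images share [R], which fixes the size of [L] by domination, hence the place where the
   block begins. *)
- move=> [B [R L]] [B' [R' L']] [/= _ [[/= RL dL _ _] _ _]].
  move=> [/= _ [[/= RL' dL' _ _] _ _]] [eLB eR]; rewrite -{}eR in RL' dL' eLB *.
  have eL := dominated_size RL dL RL' dL'.
  move/eqP: eLB; rewrite eqseq_cat // => /andP[/eqP<- /eqP]; rewrite eL.
  by move/shift_inj->.
move=> [L R] [/= L0 [[/= LR dR ncL ncR] PL QR]].
have eL := filter_above LR ncL; have dL := dominated_filter_above LR.
set L' := filter _ L in eL dL; set B := filter _ L in eL.
have L'B : below (R ++ L') B.
  have hB x r : x \in B -> r \in R -> r < x by rewrite mem_filter => /andP[/allP + _]; apply.
  move=> x y; rewrite mem_cat => /orP[xR yB|/dL[r rR ltr] yB]; first exact: hB.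
  exact: ltn_trans ltr (hB _ _ yB rR).
have [] : isperm (R ++ L') /\ exists2 w, isperm w & B = shift (size (R ++ L')) w.
  apply: isperm_cat_split => //; rewrite -catA; apply: ispermC.
  by rewrite -eL.
move=> RL' [w wP eB].
(* The largest value lies in [L] by domination, but not in [L'], whose letters are all exceeded in
   [R]. *)
have B0 : B != [::].
  have [_ ltLR] := LR; have n0 : 0 < size L by case: (L) L0.
  have : (size (L ++ R)).-1 \in L ++ R by rewrite isperm_mem // size_cat; lia.
  move: (size (L ++ R)) ltLR => n ltLR; rewrite mem_cat => /orP[mL|/dR[x xL ltx]]; last first.
    by have := ltLR x; rewrite mem_cat xL => /(_ isT); lia.
  apply/eqP => Bnil.
  have : n.-1 \in L' by rewrite -[L'](cats0) -Bnil -eL.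
  by move/dL => [r rR]; have := ltLR r; rewrite mem_cat rR orbT => /(_ isT); lia.
have [P2L P1B] : P2 L' /\ P1 B.
  apply/Pcat; rewrite -?eL // => x y xL'; apply: L'B.
  by rewrite mem_cat xL' orbT.
exists (w, (R, L')); last by rewrite /= -size_cat -eB -eL.
split=> /=.
  split; first by apply: contraNneq B0 => w0; rewrite eB w0.
  by split=> //; rewrite eB P1shift in P1B.
split=> //; split=> //.
  by apply: noncross_sub ncR => // x; rewrite mem_filter => /andP[].
by apply: noncross_sub ncL => //; apply: filter_subseq.
Qed.

End Classes.

(** * Decompositions around the minimum *)

Section Equations.
Implicit Types (P Q : seq nat -> Prop) (w L R B T : seq nat).

Lemma shift_mono m : {mono addn m : x y / x < y}.
Proof. by move=> x y; rewrite ltn_add2l. Qed.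

Lemma avA_shift m w : av occA (shift m w) <-> av occA w.
Proof. by apply: av_map => s; apply: occA_map; apply: shift_mono. Qed.

Lemma av213_shift m w : av occ213 (shift m w) <-> av occ213 w.
Proof. by apply: av_map => s; apply: occ213_map; apply: shift_mono. Qed.

Lemma av21_shift m w : av occ21 (shift m w) <-> av occ21 w.
Proof. by apply: av_map => s; apply: occ21_map; apply: shift_mono. Qed.

Lemma av_nil p : ~~ p [::] -> av p [::].
Proof. by move=> p0 s; rewrite subseq0 => /eqP->. Qed.

Lemma noncross_shift m L R : noncross (shift m L) (shift m R) <-> noncross L R.
Proof.
split=> nc x y r.
  move=> xyL rR; rewrite -(shift_mono m y) -(shift_mono m r); apply: nc.
    exact: (map_subseq (addn m) xyL).
  exact: map_f.
case/subseq_mapP => -[|x' [|y' []]] // xyL [-> ->] /mapP[r' rR ->].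
by rewrite !shift_mono; apply: nc.
Qed.

Lemma dominated_shift m L R : dominated (shift m R) (shift m L) <-> dominated R L.
Proof.
split=> dom r.
  move=> rR; have [|_ /mapP[l lL ->]] := dom (m + r); first exact: map_f.
  by rewrite shift_mono => ltrl; exists l.
case/mapP => {}r /dom[l lL ltrl] ->; exists (m + l); first exact: map_f.
by rewrite shift_mono.
Qed.

Lemma shift1_gt0 L R x : x \in shift 1 L ++ shift 1 R -> 0 < x.
Proof. by rewrite mem_cat => /orP[]; apply: mem_shift. Qed.

(* The entries right of the minimum that exceed everything on its left form a
   final, unconstrained direct summand. *)
Lemma counts_avA a k :
  counts (words (av occA)) size a ->
  counts (pairs (av occA) (av occ213)) psize k ->
  counts (words1 (av occA)) size (sX * (a * k))%R.
Proof.
move=> ca ck.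
pose g (p : seq nat * seq nat) := shift 1 p.1 ++ 0 :: shift 1 p.2.
apply: (counts_image (f := fun t => g t.2 ++ shift (size (g t.2)) t.1)
  _ _ _ (counts_atom (counts_mul ca ck))).
- move=> [T [L R]] [/= [Tp avT] [[/= LR dR ncL ncR] avL avR]].
  split; last first.
    by rewrite /psize /= !size_cat /= !size_shift; lia.
  split; first by rewrite /g; case: (shift 1 L).
  have gp : isperm (g (L, R)) by exact: (isperm_cons0 _ _).1 LR.
  split; first exact: isperm_cat.
  apply/avA_cat.
    by move=> x y xg /mem_shift; apply: leq_trans; have [_] := gp; apply.
  split; last exact/avA_shift.
  apply/avA_min; first exact: shift1_gt0.
    exact/dominated_shift.
  by split; [exact/avA_shift | exact/av213_shift | exact/noncross_shift | exact/noncross_shift].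
(* The position of 0 recovers [L], and domination then gives the size of [R], hence where [T]
   begins. *)
- move=> [T [L R]] [T' [L' R']] [/= _ [[/= LR dR _ _] _ _]].
  move=> [/= _ [[/= LR' dR' _ _] _ _]].
  rewrite /g /= -!catA /=.
  have zn X : 0 \notin shift 1 X by apply/negP => /mem_shift.
  move=> e.
  have eL : L = L'.
    have := congr1 (index 0) e; rewrite !index_cat !(negbTE (zn _)) /= !addn0 !size_shift => eL.
    by move/eqP: e; rewrite eqseq_cat ?size_shift // => /andP[/eqP/shift_inj].
  rewrite -{}eL in LR' dR' e *.
  have eR := dominated_size LR dR LR' dR'.
  move/eqP: e; rewrite eqseq_cat // => /andP[_ /eqP[/eqP]].
  rewrite eqseq_cat ?size_shift // => /andP[/eqP/shift_inj-> /eqP].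
  by rewrite !size_cat /= !size_shift => /shift_inj->.
move=> w [w0 [wp avw]].
have [L [R0 [LR0 ew]]] := isperm_split0 wp w0; rewrite {}ew {w wp w0} in avw *.
have [/noncross_shift ncL /noncross_shift ncR0] := avA_min_noncross (@shift1_gt0 L R0) avw.
have R0L := ispermC LR0.
have eR := filter_above R0L ncR0; have dR := dominated_filter_above R0L.
set R := filter _ R0 in eR dR; set B := filter _ R0 in eR.
have LRB : below (L ++ R) B.
  have hB x r : x \in B -> r \in L -> r < x by rewrite mem_filter => /andP[/allP + _]; apply.
  move=> x y; rewrite mem_cat => /orP[xL yB|/dR[l lL ltl] yB]; first exact: hB.
  exact: ltn_trans ltl (hB _ _ yB lL).
have [] : isperm (L ++ R) /\ exists2 w, isperm w & B = shift (size (L ++ R)) w.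
  by apply: isperm_cat_split => //; rewrite -catA -eR.
move=> LR [T Tp eB].
(* The shift by 1 that makes room for the minimum is absorbed by the size of [g (L, R)], one more
   than that of [L ++ R]. *)
have eg : shift 1 L ++ 0 :: shift 1 R0 = g (L, R) ++ shift (size (g (L, R))) T.
  rewrite eR eB /g /= -catA /= /shift map_cat -map_comp; congr (_ ++ _ :: _ ++ _).
  by apply: eq_map => x /=; rewrite !size_cat /= !size_map; lia.
have [avg avT] : av occA (g (L, R)) /\ av occA (shift (size (g (L, R))) T).
  apply/avA_cat; last by rewrite -eg.
  move=> x y xg /mem_shift; apply: leq_trans.
  by have [_] := (isperm_cons0 _ _).1 LR; apply.
exists (T, (L, R)) => //=.
split; first by split=> //; exact: (avA_shift _ _).1 avT.
move/avA_min: avg => [||avL avR _ _]; first exact: shift1_gt0.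
  exact/dominated_shift.
split=> /=; [split=> // | exact: (avA_shift _ _).1 avL | exact: (av213_shift _ _).1 avR].
  by apply: noncross_sub ncL => // x; rewrite mem_filter => /andP[].
by apply: noncross_sub ncR0 => //; apply: filter_subseq.
Qed.

(** Everything right of the minimum lies below everything left of it, so the two sides are
    independent: the Catalan decomposition. *)
Lemma counts_213 a :
  counts (words (av occ213)) size a ->
  counts (words1 (av occ213)) size (sX * (a * a))%R.
Proof.
move=> ca.
apply: (counts_image (f := fun t => shift 1 (shift (size t.2) t.1) ++ 0 :: shift 1 t.2)
  _ _ _ (counts_atom (counts_mul ca ca))).
- move=> [L R] [/= [Lp avL] [Rp avR]].
  split; last by rewrite /= !size_cat /= !size_shift; lia.
  split; first by case: (shift 1 (shift _ _)).
  split; first exact: (isperm_cons0 _ _).1 (ispermC (isperm_cat Rp Lp)).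
  apply/av213_min_cat; last 1 first.
  + by split; [apply/av213_shift/av213_shift | apply/av213_shift].
  + move=> _ _ /mapP[x xR ->] /mapP[y /mem_shift + ->]; rewrite shift_mono.
    by apply: leq_trans; have [_] := Rp; apply.
  exact: shift1_gt0.
- move=> [L R] [L' R'] _ _ /= e.
  have zn X : 0 \notin shift 1 X by apply/negP => /mem_shift.
  have eL : size L = size L'.
    by have := congr1 (index 0) e; rewrite !index_cat !(negbTE (zn _)) /= !addn0 !size_shift.
  move/eqP: e; rewrite eqseq_cat ?size_shift // => /andP[/eqP/shift_inj e1 /eqP[e2]].
  by move: e1; rewrite (shift_inj e2) => /shift_inj->.
move=> w [w0 [wp avw]].
have [L0 [R [LR0 ew]]] := isperm_split0 wp w0; rewrite {}ew {w wp w0} in avw *.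
have RL : below R L0.
  move=> r x rR xL; have := av213_min (@shift1_gt0 L0 R) avw.
  move=> /(_ (1 + x) (1 + r)); rewrite !map_f // => /(_ isT isT).
  rewrite leq_add2l leq_eqVlt => /orP[/eqP erx|//].
  have [+ _] := LR0; rewrite cat_uniq => /and3P[_ /hasPn/(_ r rR) /= + _].
  by rewrite erx xL.
have [Rp [L Lp eL]] := isperm_cat_split RL (ispermC LR0).
exists (L, R); last by rewrite /= -eL.
move/av213_min_cat: avw => [||avL avR].
- by move=> _ _ /mapP[r rR ->] /mapP[x xL ->]; rewrite shift_mono; apply: RL.
- exact: shift1_gt0.
split; split=> //=; last by exact: (av213_shift _ _).1 avR.
by rewrite eL in avL; move/av213_shift/av213_shift: avL.
Qed.

(** An entry before the minimum would form a 21 with it, so the minimum comes first. *)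
Lemma counts_21 a :
  counts (words (av occ21)) size a ->
  counts (words1 (av occ21)) size (sX * a)%R.
Proof.
move=> ca; apply: (counts_image (f := fun w => 0 :: shift 1 w) _ _ _ (counts_atom ca)).
- move=> w [wp avw]; rewrite /= size_shift; split=> //; split=> //.
  split; first exact: (isperm_cons0 [::] _).1.
  by apply/av21_min/av21_shift.
- by move=> w w' _ _ [/shift_inj].
move=> w [w0 [wp avw]].
have [L [R [LR ew]]] := isperm_split0 wp w0; rewrite {}ew {w wp w0} in avw *.
case: L LR avw => [|x L] LR avw.
  by exists R => //; split; [exact: LR | exact: (av21_shift 1 R).1 ((av21_min _).1 avw)].
have : subseq ([:: 1 + x] ++ [:: 0]) (shift 1 (x :: L) ++ 0 :: shift 1 R).
  by apply: cat_subseq; rewrite sub1seq; [apply: map_f|]; apply: mem_head.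
by move/avw.
Qed.

End Equations.

(** * Elements of ['S_n] as words *)

Section Permutations.

Definition permword n (s : 'S_n) : seq nat := [seq val (s i) | i <- enum 'I_n].

Lemma size_permword n (s : 'S_n) : size (permword s) = n.
Proof. by rewrite size_map size_enum_ord. Qed.

Lemma isperm_permword n (s : 'S_n) : isperm (permword s).
Proof.
split=> [|x /mapP[i _ ->]]; last by rewrite size_permword ltn_ord.
by rewrite map_inj_uniq ?enum_uniq // => i j /val_inj/perm_inj.
Qed.

Lemma permword_inj n : injective (@permword n).
Proof.
move=> s t /eq_in_map st; apply/permP => i; apply/val_inj/st.
by rewrite mem_enum.
Qed.

Lemma permword_surj w : w != [::] -> isperm w -> exists s : 'S_(size w), permword s = w.
Proof.
move: {2}(size w) (erefl (size w)) => [|n] en; first by move/size0nil: en => ->.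
move=> _ wP; have [uw ltw] := wP; rewrite en in ltw *.
pose f (i : 'I_n.+1) : 'I_n.+1 := inord (nth 0 w i).
have valf i : val (f i) = nth 0 w i by rewrite /= inordK // ltw // mem_nth // en.
have finj : injective f.
  move=> i j /(congr1 val); rewrite !valf => /eqP.
  by rewrite nth_uniq ?en // => /eqP/val_inj.
exists (perm finj); rewrite /permword.
rewrite (eq_map (g := nth 0 w \o val)) => [|i]; last by rewrite permE valf.
by rewrite map_comp val_enum_ord -en; apply: mkseq_nth.
Qed.

(** Links the increasing embeddings in [contains] to [subseq]: a strictly increasing list is
    determined by its members. *)
Lemma subseq_enum_ord n (ks : seq 'I_n) :
  subseq ks (enum 'I_n) = sorted ltn (map val ks).
Proof.
apply/idP/idP => [sub|srt].
  apply: (subseq_sorted ltn_trans (map_subseq val sub)).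
  by rewrite val_enum_ord iota_ltn_sorted.
have -> : ks = filter [in ks] (enum 'I_n); last exact: filter_subseq.
apply: (inj_map val_inj); apply: (irr_sorted_eq ltn_trans ltnn) => //.
  apply: (subseq_sorted ltn_trans (map_subseq val (filter_subseq _ _))).
  by rewrite val_enum_ord iota_ltn_sorted.
move=> x; apply/mapP/mapP => -[i iks ->]; exists i => //.
  by rewrite mem_filter mem_enum andbT.
by move: iks; rewrite mem_filter => /andP[].
Qed.

Lemma containsP n (s : 'S_n) a b c d :
  reflect (exists i j k l : 'I_n, [/\ i < j < k, k < l &
    forall x y, x < 4 -> y < 4 ->
      (nth 0 [:: val (s i); val (s j); val (s k); val (s l)] x <
       nth 0 [:: val (s i); val (s j); val (s k); val (s l)] y)
      = (nth 0 [:: a; b; c; d] x < nth 0 [:: a; b; c; d] y)])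
  (contains s [:: a; b; c; d]).
Proof.
apply: (iffP existsP) => [[phi /forallP phiP]|[i [j [k [l [/andP[ij jk] kl oP]]]]]].
  pose o (m : nat) (lt : m < 4) : 'I_(size [:: a; b; c; d]) := Ordinal lt.
  have inc x y (ltx : x < 4) (lty : y < 4) : x < y -> phi (o x ltx) < phi (o y lty).
    by have /forallP/(_ (o y lty))/andP[/implyP H _] := phiP (o x ltx); apply: H.
  have ord x y (ltx : x < 4) (lty : y < 4) :
      (s (phi (o x ltx)) < s (phi (o y lty)))
      = (nth 0 [:: a; b; c; d] x < nth 0 [:: a; b; c; d] y).
    by have /forallP/(_ (o y lty))/andP[_ /eqP] := phiP (o x ltx).
  exists (phi (o 0 isT)), (phi (o 1 isT)), (phi (o 2 isT)), (phi (o 3 isT)).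
  split; rewrite ?inc //.
  by move=> [|[|[|[|?]]]] [|[|[|[|?]]]] // _ _; apply: ord.
exists [ffun x : 'I_4 => nth i [:: i; j; k; l] x].
apply/forallP => -[x ltx]; apply/forallP => -[y lty]; rewrite !ffunE /=.
have H := oP x y ltx lty.
apply/andP; split; last first.
  rewrite -H; apply/eqP.
  by case: x ltx {H} => [|[|[|[|?]]]] //; case: y lty => [|[|[|[|?]]]].
apply/implyP; case: x ltx {H} => [|[|[|[|?]]]] //; case: y lty => [|[|[|[|?]]]] //= _ _ _;
  lia.
Qed.

Lemma avoids_permword n (s : 'S_n) :
  avoids s pat4213 && avoids s pat3142 <-> av occA (permword s).
Proof.
split=> [/andP[/containsP av1 /containsP av2] t|avs].
  case/subseqP => m szm ->; rewrite -map_mask.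
  have := mask_subseq m (enum 'I_n); rewrite subseq_enum_ord.
  case: (mask m _) => [|i [|j [|k [|l []]]]] //= /and4P[ij jk kl _].
  apply/negP => /orP[] H.
    apply: av1; exists i, j, k, l; split=> //; first by rewrite ij.
    by move=> [|[|[|[|?]]]] [|[|[|[|?]]]] // _ _ /=; lia.
  apply: av2; exists i, j, k, l; split=> //; first by rewrite ij.
  by move=> [|[|[|[|?]]]] [|[|[|[|?]]]] // _ _ /=; lia.
have sub (i j k l : 'I_n) : i < j < k -> k < l ->
    subseq [:: val (s i); val (s j); val (s k); val (s l)] (permword s).
  move=> ijk kl; apply: (map_subseq (fun i => val (s i)) (s1 := [:: i; j; k; l])).
  by rewrite subseq_enum_ord /= kl !andbT.
apply/andP; split; apply/containsP => -[i [j [k [l [ijk kl o]]]]];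
  have /negP := avs _ (sub _ _ _ _ ijk kl); apply => /=.
  (* Positions in increasing order of value are 2, 1, 3, 0 for 4213 and 1, 3, 0, 2 for 3142; the
     three consecutive comparisons suffice. *)
  by have /= := o 2 1 isT isT; have /= := o 1 3 isT isT; have /= := o 3 0 isT isT; lia.
by have /= := o 1 3 isT isT; have /= := o 3 0 isT isT; have /= := o 0 2 isT isT; lia.
Qed.

Lemma counts_f_av : counts (words1 (av occA)) size f_av.
Proof.
move=> [|n].
  exists [::]; split=> // w; split=> // -[[w0 _] sz0].
  by rewrite (size0nil sz0) in w0.
exists [seq permword s | s <- enum [set s : 'S_n.+1 | avoids s pat4213 && avoids s pat3142]].
split; last by rewrite size_map -cardE.
  by rewrite map_inj_uniq ?enum_uniq //; apply: permword_inj.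
move=> w; split=> [/mapP[s]|[[w0 [wP avw]] szw]].
  rewrite mem_enum inE => /avoids_permword avs ->; split; last exact: size_permword.
  split; first by rewrite -size_eq0 size_permword.
  by split=> //; apply: isperm_permword.
have [s sw] := permword_surj w0 wP; rewrite szw in s sw.
apply/mapP; exists s => //; rewrite mem_enum inE.
by apply/avoids_permword; rewrite sw.
Qed.

End Permutations.

Theorem theorem2p1 : forall n : nat, eval_eqn f_av n = 0%R.
Proof.
have nilA : av occA [::] by apply: av_nil.
have nil213 : av occ213 [::] by apply: av_nil.
have nil21 : av occ21 [::] by apply: av_nil.
have cF := counts_words nilA counts_f_av.
have [c1 cc1] := counts_words1 (av occ213).
have cC := counts_words nil213 cc1.
have eC := counts_unique cc1 (counts_213 cC).
have [j1 cj1] := counts_words1 (av occ21).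
have cJ := counts_words nil21 cj1.
have eJ := counts_unique cj1 (counts_21 cJ).
have [k1 ck1] := counts_pairs (av occA) (av occ213).
have [k2 ck2] := counts_pairs (av occ213) (av occA).
have [k3 ck3] := counts_pairs (av occA) (av occ21).
have [k4 ck4] := counts_pairs (av occ21) (av occA).
have ef := counts_unique counts_f_av (counts_avA cF ck1).
have Acat L B : below L B -> B != [::] -> av occA (L ++ B) <-> av occA L /\ av occA B.
  by move=> LB _; apply: avA_cat.
have Icat L B : below L B -> B != [::] -> av occ21 (L ++ B) <-> av occ21 L /\ av occ21 B.
  by move=> LB _; apply: av21_cat.
(* Every peeling exchanges the two conditions. The chain closes because the pairs left in [e4] are
   again those counted by [k3]. *)
have e1 := counts_unique ck1 (counts_peel Acat avA_shift nilA nil213 counts_f_av ck2).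
have e2 := counts_unique ck2 (counts_peel av213_cat av213_shift nil213 nilA cc1 ck3).
have e3 := counts_unique ck3 (counts_peel Acat avA_shift nilA nil21 counts_f_av ck4).
have e4 := counts_unique ck4 (counts_peel Icat av21_shift nil21 nilA cj1 ck3).
move=> n; rewrite (@eval_eqn_system f_av (1 + c1) (1 + j1) k1 k2 k3 k4)%R //.
- by rewrite {1}ef mulrA.
(* [c1] counts nonempty words, so it is [C - 1]; likewise [j1] is [J - 1]. *)
- by rewrite {1}e2 [(1 + c1)%R]addrC addrK.
- by rewrite {1}e4 [(1 + j1)%R]addrC addrK.
- by rewrite {1}eC mulrA.
- by rewrite {1}eJ.
Qed.
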